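(* There exists an infinite computable CSC space which is effectively Hausdorff via a computable witness and is discrete, but has no infinite computable subspace that is effectively discrete via a computable witness.
   Context: A CSC space is a tuple $\langle X,\mathcal{U},k\rangle$ where $X\subseteq\omega$; $\mathcal{U}=\langle U_n:n\in\omega\rangle$ is a sequence of subsets of $X$ such that every $x\in X$ belongs to some $U_n$; and $k:X\times\omega\times\omega\to\omega$ is such that whenever $x\in U_m\cap U_n$, $x\in U_{k(x,m,n)}\subseteq U_m\cap U_n$. Write $U\in\mathcal{U}$ if $U=U_n$ for some $n$. It is computable if $X$ is computable, $\mathcal{U}$ is uniformly computable, and $k$ is computable. It is discrete if $\{x\}\in\mathcal{U}$ for all $x\in X$. It is effectively Hausdorff if there is a function $e:X\times X\to\omega$ such that for distinct $x,y\in X$, $e(x,y)=\langle m,n\rangle$ with $x\in U_m$, $y\in U_n$, $U_m\cap U_n=\emptyset$. For $Y\subseteq X$, the subspace $Y$ has basis $\langle U_n\cap Y\rangle$; it is effectively discrete via $d:Y\to\omega$ if $U_{d(x)}\cap Y=\{x\}$ for all $x\in Y$. *)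

(* Defs.v *)
From Stdlib Require Import Arith Ensembles Constructive_sets Finite_sets.
From Stdlib Require Cantor.

(** * Partial recursive functions

    The unary partial recursive functions on codes: arguments of functions of
    several variables are packed with Cantor's pairing function. *)

Notation "<< a , b >>" := (Cantor.to_nat (a, b))
  (at level 0, a at level 99, b at level 99, format "<< a ,  b >>").

Inductive code : Set :=
| Zero : code
| Succ : code
| Left : code
| Right : code
| Pair (f g : code) : code
| Comp (f g : code) : code
| Prec (f g : code) : code
| Mu (f : code) : code.

(** [eval c x y]: program [c] halts on input [x] with output [y].
    - [Prec f g] maps [<<a, 0>>] to [f a], and [<<a, i + 1>>] to
      [g <<a, <<i, v>>>>] where [v] is its value at [<<a, i>>]; the sequence [s]
      lists these values.
    - [Mu f] maps [x] to the least [y] with [f <<x, y>> = 0], where [f] must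
      converge on all [<<x, i>>] with [i < y]. *)
Fixpoint eval (c : code) (x y : nat) {struct c} : Prop :=
  match c with
  | Zero => y = 0
  | Succ => y = S x
  | Left => y = fst (Cantor.of_nat x)
  | Right => y = snd (Cantor.of_nat x)
  | Pair f g => exists a b, eval f x a /\ eval g x b /\ y = <<a, b>>
  | Comp f g => exists z, eval g x z /\ eval f z y
  | Prec f g =>
      exists (a n : nat) (s : nat -> nat),
        x = <<a, n>> /\ eval f a (s 0) /\
        (forall i, i < n -> eval g <<a, <<i, s i>>>> (s (S i))) /\ y = s n
  | Mu f =>
      eval f <<x, y>> 0 /\
      forall i, i < y -> exists v, eval f <<x, i>> (S v)
  end.

Definition computable_set (A : Ensemble nat) : Prop :=
  exists c, forall x, (A x -> eval c x 1) /\ (~ A x -> eval c x 0).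

Definition uniformly_computable (U : nat -> Ensemble nat) : Prop :=
  exists c, forall n x,
    (U n x -> eval c <<n, x>> 1) /\ (~ U n x -> eval c <<n, x>> 0).

(** Functions on a subset of [nat] are represented by total Rocq functions whose
    values off the intended domain are irrelevant; accordingly, the programs
    below are unconstrained on inputs outside that domain. *)

(** [f : D -> nat] *)
Definition computable1 (D : Ensemble nat) (f : nat -> nat) : Prop :=
  exists c, forall x, D x -> eval c x (f x).

(** [f : D * D -> nat] *)
Definition computable2 (D : Ensemble nat) (f : nat -> nat -> nat) : Prop :=
  exists c, forall x y, D x -> D y -> eval c <<x, y>> (f x y).

(** [f : D * nat * nat -> nat] *)
Definition computable3 (D : Ensemble nat) (f : nat -> nat -> nat -> nat) : Prop :=
  exists c, forall x m n, D x -> eval c <<x, <<m, n>>>> (f x m n).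

(** * CSC spaces *)

Record CSC : Type := MkCSC {
  points : Ensemble nat;
  basis : nat -> Ensemble nat;
  kfun : nat -> nat -> nat -> nat;
  basis_sub : forall n, Included nat (basis n) points;
  basis_cover : forall x, points x -> exists n, basis n x;
  kfun_spec : forall x m n,
    basis m x -> basis n x ->
    basis (kfun x m n) x /\
    Included nat (basis (kfun x m n)) (Intersection nat (basis m) (basis n))
}.

Definition infinite (X : CSC) : Prop := ~ Finite nat (points X).

Definition computable_CSC (X : CSC) : Prop :=
  computable_set (points X) /\
  uniformly_computable (basis X) /\
  computable3 (points X) (kfun X).

Definition discrete (X : CSC) : Prop :=
  forall x, points X x -> exists n, Same_set nat (basis X n) (Singleton nat x).

Definition effectively_Hausdorff_via (X : CSC) (e : nat -> nat -> nat) : Prop :=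
  forall x y, points X x -> points X y -> x <> y ->
  exists m n, e x y = <<m, n>> /\ basis X m x /\ basis X n y /\
    Same_set nat (Intersection nat (basis X m) (basis X n)) (Empty_set nat).

Definition effectively_discrete_via (X : CSC) (d : nat -> nat) : Prop :=
  forall x, points X x -> Same_set nat (basis X (d x)) (Singleton nat x).

Definition subspace (X : CSC) (Y : Ensemble nat)
  (YX : Included nat Y (points X)) : CSC.
Proof.
refine (MkCSC Y (fun n => Intersection nat (basis X n) Y) (kfun X) _ _ _).
- intros n x H; exact (proj2 (Intersection_inv _ _ _ _ H)).
- intros x Yx; destruct (basis_cover X x (YX x Yx)) as [n Un].
  exists n; split; assumption.
- intros x m n Hm Hn.
  destruct (Intersection_inv _ _ _ _ Hm) as [Um Yx].
  destruct (Intersection_inv _ _ _ _ Hn) as [Un _].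
  destruct (kfun_spec X x m n Um Un) as [Uk sub].
  split; [split; assumption |].
  intros z Hz; destruct (Intersection_inv _ _ _ _ Hz) as [Uz Yz].
  destruct (Intersection_inv _ _ _ _ (sub z Uz)) as [Umz Unz].
  split; split; assumption.
Defined.

(* Main.v *)
Require Import Defs.
From Stdlib Require Import Ensembles Constructive_sets Finite_sets.
From Stdlib Require Import Arith Lia Classical FunctionalExtensionality PropExtensionality.
From Stdlib Require Cantor.

(** Put on [nat] a computable tree in which every [z > 0] has a parent below it
    and the edge to the parent carries a label. The basic set with index
    [<<x, l>>] consists of [x] and of the subtrees at those children of [x] whose
    label is at least [l]. If [x] lies above [y], cutting at [x] above the label
    of the edge that leads to [y] separates them, so the space is effectively
    Hausdorff; it is discrete as soon as the labels below each point are bounded.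

    The tree is built greedily. At stage [z] the requirements [e < z] are visited
    in turn, starting from the whole tree. If within [z] steps the two programs
    coded by [e] declare some [x] to be in [Y] and to have the witness [d x], and
    the centre of the basic set with index [d x] lies strictly inside the current
    basic set, then that set becomes the current one. Finally [z] is put into the
    last current set, by an edge from its centre. Since the least suitable [x] is
    chosen, the choice of each [e] stabilizes as [z] grows; if it stabilizes to
    [d x], then the basic set [d x] contains almost all numbers, so its trace on
    an infinite [Y] is not [{x}]. A requirement only uses centres [>= e], which
    bounds the labels below each point. *)

(** * Total computable functions and their closure properties *)

Definition pi1 (n : nat) : nat := fst (Cantor.of_nat n).
Definition pi2 (n : nat) : nat := snd (Cantor.of_nat n).

Lemma pi1_pair a b : pi1 <<a, b>> = a.
Proof. unfold pi1; now rewrite Cantor.cancel_of_to. Qed.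

Lemma pi2_pair a b : pi2 <<a, b>> = b.
Proof. unfold pi2; now rewrite Cantor.cancel_of_to. Qed.

Lemma pair_pi n : <<pi1 n, pi2 n>> = n.
Proof.
unfold pi1, pi2; rewrite <- surjective_pairing; apply Cantor.cancel_to_of.
Qed.

Lemma pi1_le n : pi1 n <= n.
Proof.
pose proof (Cantor.to_nat_non_decreasing (pi1 n) (pi2 n)) as H.
rewrite pair_pi in H; lia.
Qed.

Lemma pi2_le n : pi2 n <= n.
Proof.
pose proof (Cantor.to_nat_non_decreasing (pi1 n) (pi2 n)) as H.
rewrite pair_pi in H; lia.
Qed.

Definition comp (f : nat -> nat) : Prop := exists c, forall x, eval c x (f x).
Definition compb (f : nat -> bool) : Prop := comp (fun x => Nat.b2n (f x)).

Lemma comp_pair f g : comp f -> comp g -> comp (fun x => <<f x, g x>>).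
Proof.
intros [c Hc] [d Hd]; exists (Pair c d); intro x; exists (f x), (g x); auto.
Qed.

Lemma comp_app f g : comp f -> comp g -> comp (fun x => f (g x)).
Proof. intros [c Hc] [d Hd]; exists (Comp c d); intro x; exists (g x); auto. Qed.

Lemma comp_pi1 f : comp f -> comp (fun x => pi1 (f x)).
Proof. apply comp_app; exists Left; reflexivity. Qed.

Lemma comp_pi2 f : comp f -> comp (fun x => pi2 (f x)).
Proof. apply comp_app; exists Right; reflexivity. Qed.

Lemma comp_S f : comp f -> comp (fun x => S (f x)).
Proof. apply (comp_app S); exists Succ; reflexivity. Qed.

Lemma comp_id : comp (fun x => x).
Proof.
exists (Pair Left Right); intro x; exists (pi1 x), (pi2 x).
repeat split; symmetry; apply pair_pi.
Qed.

Lemma comp_const k : comp (fun _ => k).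
Proof.
induction k; [exists Zero; reflexivity | now apply comp_S].
Qed.

Lemma comp_rec b N st :
  comp b -> comp N ->
  comp (fun t => st (pi1 t) (pi1 (pi2 t)) (pi2 (pi2 t))) ->
  comp (fun x => nat_rect (fun _ => nat) (b x) (st x) (N x)).
Proof.
intros [cb Hb] HN [cs Hs].
destruct (comp_pair _ _ comp_id HN) as [cp Hp].
(* The recursion parameter is the whole input [x], so the base and the step may both depend on
   it. *)
exists (Comp (Prec cb cs) cp); intro x; exists <<x, N x>>; split; [apply Hp |].
exists x, (N x), (nat_rect (fun _ => nat) (b x) (st x)).
repeat split; [apply Hb |]; intros i _.
specialize (Hs <<x, <<i, nat_rect (fun _ => nat) (b x) (st x) i>>>>).
rewrite !pi2_pair, !pi1_pair in Hs; exact Hs.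
Qed.

Lemma comp_iter N st b :
  comp N -> comp (fun t => st (pi1 t) (pi2 t)) -> comp b ->
  comp (fun x => Nat.iter (N x) (st x) (b x)).
Proof.
intros HN Hs Hb; apply (comp_rec b N (fun x _ => st x)); trivial.
destruct (comp_app _ (fun t => <<pi1 t, pi2 (pi2 t)>>) Hs) as [c Hc].
{ apply comp_pair; repeat first [apply comp_pi1 | apply comp_pi2 | apply comp_id]. }
exists c; intro t; specialize (Hc t).
rewrite pi1_pair, pi2_pair in Hc; exact Hc.
Qed.

Lemma comp_case N a b :
  comp N -> comp a -> comp (fun t => b (pi1 t) (pi2 t)) ->
  comp (fun x => match N x with 0 => a x | S k => b x k end).
Proof.
intros HN Ha Hb.
destruct (comp_rec a N (fun x k _ => b x k) Ha HN) as [c Hc].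
- destruct (comp_app _ (fun t => <<pi1 t, pi1 (pi2 t)>>) Hb) as [c Hc].
  { apply comp_pair; repeat first [apply comp_pi1 | apply comp_pi2 | apply comp_id]. }
  exists c; intro t; specialize (Hc t).
  rewrite pi1_pair, pi2_pair in Hc; exact Hc.
- exists c; intro x; specialize (Hc x); destruct (N x); exact Hc.
Qed.

Lemma comp_if P a b :
  compb P -> comp a -> comp b -> comp (fun x => if P x then a x else b x).
Proof.
intros HP Ha Hb.
destruct (comp_case _ b (fun x _ => a x) HP Hb) as [c Hc].
- exact (comp_app a pi1 Ha (comp_pi1 _ comp_id)).
- exists c; intro x; specialize (Hc x); destruct (P x); exact Hc.
Qed.

Lemma comp_sub f g : comp f -> comp g -> comp (fun x => f x - g x).
Proof.
intros Hf Hg.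
destruct (comp_iter g (fun _ v => match v with 0 => 0 | S k => k end) f) as [c Hc];
  trivial.
- apply (comp_case _ (fun _ => 0) (fun _ k => k));
    [apply comp_pi2, comp_id | apply comp_const | apply comp_pi2, comp_id].
- exists c; intro x; specialize (Hc x).
  replace (f x - g x) with
    (Nat.iter (g x) (fun v => match v with 0 => 0 | S k => k end) (f x));
    [exact Hc |].
  clear Hc; induction (g x) as [| n IH]; [simpl; lia | rewrite Nat.iter_succ, IH].
  destruct (f x - n) eqn:E; lia.
Qed.

Lemma compb_leb f g : comp f -> comp g -> compb (fun x => f x <=? g x).
Proof.
intros Hf Hg.
destruct (comp_case _ (fun _ => 1) (fun _ _ => 0) (comp_sub _ _ Hf Hg))
  as [c Hc]; try apply comp_const.
exists c; intro x; specialize (Hc x).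
destruct (Nat.leb_spec (f x) (g x)) as [H | H];
  destruct (f x - g x) eqn:E; try lia; exact Hc.
Qed.

Lemma compb_andb P Q : compb P -> compb Q -> compb (fun x => P x && Q x)%bool.
Proof.
intros HP HQ; destruct (comp_if _ _ _ HP HQ (comp_const 0)) as [c Hc].
exists c; intro x; specialize (Hc x); destruct (P x); exact Hc.
Qed.

Lemma compb_ltb f g : comp f -> comp g -> compb (fun x => f x <? g x).
Proof. intros Hf Hg; exact (compb_leb _ _ (comp_S _ Hf) Hg). Qed.

Lemma compb_eqb f g : comp f -> comp g -> compb (fun x => f x =? g x).
Proof.
intros Hf Hg.
destruct (compb_andb _ _ (compb_leb _ _ Hf Hg) (compb_leb _ _ Hg Hf)) as [c Hc].
exists c; intro x; specialize (Hc x); cbv beta in Hc.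
destruct (Nat.eqb_spec (f x) (g x)), (Nat.leb_spec (f x) (g x)),
  (Nat.leb_spec (g x) (f x)); try lia; exact Hc.
Qed.

Ltac computable :=
  cbv beta;
  lazymatch goal with
  | |- comp (fun x => x) => exact comp_id
  | |- comp (fun _ => ?k) => exact (comp_const k)
  | |- comp pi1 => exact (comp_pi1 _ comp_id)
  | |- comp pi2 => exact (comp_pi2 _ comp_id)
  | |- comp (fun x => Cantor.to_nat (@?a x, @?b x)) =>
      apply (comp_pair a b); computable
  | |- comp (fun x => pi1 (@?a x)) => apply (comp_pi1 a); computable
  | |- comp (fun x => pi2 (@?a x)) => apply (comp_pi2 a); computable
  | |- comp (fun x => S (@?a x)) => apply (comp_S a); computable
  | |- comp (fun x => @?a x - @?b x) => apply (comp_sub a b); computable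
  | |- comp (fun x => match _ with 0 => _ | S k => _ end) =>
      apply comp_case; computable
  | |- comp (fun x => if @?P x then @?a x else @?b x) =>
      apply (comp_if P a b); computable
  | |- comp (fun x => nat_rect _ (@?b x) (@?st x) (@?N x)) =>
      apply (comp_rec b N st); computable
  | |- comp (fun x => Nat.iter (@?N x) (@?st x) (@?b x)) =>
      apply (comp_iter N st b); computable
  | |- compb (fun x => @?a x <=? @?b x) => apply (compb_leb a b); computable
  | |- compb (fun x => @?a x <? @?b x) => apply (compb_ltb a b); computable
  | |- compb (fun x => @?a x =? @?b x) => apply (compb_eqb a b); computable
  | |- compb (fun x => andb (@?a x) (@?b x)) =>
      apply (compb_andb a b); computable
  | H : comp ?f |- comp (fun x => ?f (@?g x)) => apply (comp_app f g H); computable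
  | H : comp ?f |- comp ?f => exact H
  | |- _ => idtac
  end.

(** * A universal stack machine *)

Fixpoint encode (c : code) : nat :=
  match c with
  | Zero => <<0, 0>>
  | Succ => <<1, 0>>
  | Left => <<2, 0>>
  | Right => <<3, 0>>
  | Pair f g => <<4, <<encode f, encode g>>>>
  | Comp f g => <<5, <<encode f, encode g>>>>
  | Prec f g => <<6, <<encode f, encode g>>>>
  | Mu f => <<7, <<encode f, 0>>>>
  end.

(** States of a stack machine: [run c x K] is about to run the program coded by
    [c] on [x], and [ret v K] returns [v] to the stack of frames [K]. The empty
    stack is [0], whose top frame has the tag [pi1 0 = 0]. *)
Definition run (c x K : nat) : nat := <<0, <<c, <<x, K>>>>>>.
Definition ret (v K : nat) : nat := <<1, <<v, <<0, K>>>>>>.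
Definition frame (tag p q K : nat) : nat := <<tag, <<p, <<q, K>>>>>>.

Definition step_run (c x K : nat) : nat :=
  let f := pi1 (pi2 c) in let g := pi2 (pi2 c) in
  match pi1 c with
  | 0 => ret 0 K
  | 1 => ret (S x) K
  | 2 => ret (pi1 x) K
  | 3 => ret (pi2 x) K
  | 4 => run f x (frame 1 g x K)
  | 5 => run g x (frame 3 f 0 K)
  | 6 => run f (pi1 x) (frame 4 g <<pi1 x, <<0, pi2 x>>>> K)
  | _ => run f <<x, 0>> (frame 5 f <<x, 0>> K)
  end.

(** Tag 1 awaits the first component of a pair, 2 the second, 3 the inner value of a composition.
    Tag 4 keeps [<<a, <<i, r>>>>], a recursion at index [i] with [r] rounds left; tag 5 keeps the
    input [<<x, i>>] under test in a search. Tag 0 makes a finished state a fixed point. *)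
Definition step_ret (v stack : nat) : nat :=
  let p := pi1 (pi2 stack) in let q := pi1 (pi2 (pi2 stack)) in
  let K := pi2 (pi2 (pi2 stack)) in
  match pi1 stack with
  | 0 => ret v 0
  | 1 => run p q (frame 2 v 0 K)
  | 2 => ret <<p, v>> K
  | 3 => run p v K
  | 4 => match pi2 (pi2 q) with
         | 0 => ret v K
         | S r => run p <<pi1 q, <<pi1 (pi2 q), v>>>>
                    (frame 4 p <<pi1 q, <<S (pi1 (pi2 q)), r>>>> K)
         end
  | _ => match v with
         | 0 => ret (pi2 q) K
         | S _ => run p <<pi1 q, S (pi2 q)>> (frame 5 p <<pi1 q, S (pi2 q)>> K)
         end
  end.

Definition step (s : nat) : nat :=
  match pi1 s with
  | 0 => step_run (pi1 (pi2 s)) (pi1 (pi2 (pi2 s))) (pi2 (pi2 (pi2 s)))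
  | S _ => step_ret (pi1 (pi2 s)) (pi2 (pi2 (pi2 s)))
  end.

Lemma comp_step f : comp f -> comp (fun x => step (f x)).
Proof.
apply comp_app.
unfold step, step_run, step_ret, ret, run, frame; computable.
Qed.

Lemma step_runE c x K : step (run c x K) = step_run c x K.
Proof. unfold step, run; now rewrite !pi2_pair, !pi1_pair. Qed.

Lemma step_retE v K : step (ret v K) = step_ret v K.
Proof. unfold step, ret; now rewrite !pi2_pair, !pi1_pair. Qed.

Definition reaches (s t : nat) : Prop := exists n, Nat.iter n step s = t.

Lemma reaches_trans s t u : reaches s t -> reaches t u -> reaches s u.
Proof.
intros [n Hn] [k Hk]; exists (k + n); now rewrite Nat.iter_add, Hn.
Qed.

Lemma reaches_step s t : reaches (step s) t -> reaches s t.
Proof. apply reaches_trans; exists 1; reflexivity. Qed.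

Lemma reaches_refl s : reaches s s.
Proof. exists 0; reflexivity. Qed.

Ltac machine_step :=
  apply reaches_step; rewrite ?step_runE, ?step_retE;
  unfold step_run, step_ret, frame; cbn [encode]; cbv zeta;
  rewrite ?pi2_pair, ?pi1_pair; rewrite ?pi2_pair, ?pi1_pair;
  cbv iota; try apply reaches_refl.

Lemma eval_reaches c : forall x y K,
  eval c x y -> reaches (run (encode c) x K) (ret y K).
Proof.
induction c as [| | | | f IHf g IHg | f IHf g IHg | f IHf g IHg | f IHf];
  intros x y K H; cbn [eval] in H.
- subst; machine_step.
- subst; machine_step.
- subst; machine_step.
- subst; machine_step.
- destruct H as (a & b & Ha & Hb & ->).
  machine_step. eapply reaches_trans; [apply IHf; eassumption |].
  machine_step. eapply reaches_trans; [apply IHg; eassumption |].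
  machine_step.
- destruct H as (z & Hg & Hf).
  machine_step. eapply reaches_trans; [apply IHg; eassumption |].
  machine_step. now apply IHf.
- destruct H as (a & n & s & -> & H0 & HS & ->).
  machine_step. eapply reaches_trans; [apply IHf; eassumption |].
  enough (E : forall r i, i + r = n ->
    reaches (ret (s i) (frame 4 (encode g) <<a, <<i, r>>>> K)) (ret (s n) K))
    by (apply (E n 0); lia).
  induction r as [| r IHr]; intros i Hi.
  + replace i with n by lia. machine_step.
  + machine_step. eapply reaches_trans; [apply IHg, HS; lia |].
    apply IHr; lia.
- destruct H as (H0 & HS).
  machine_step.
  enough (E : forall r i, i + r = y ->
    reaches (run (encode f) <<x, i>> (frame 5 (encode f) <<x, i>> K)) (ret y K))
    by (apply (E y 0); lia).
  induction r as [| r IHr]; intros i Hi.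
  + replace i with y by lia. eapply reaches_trans; [apply IHf; eassumption |].
    machine_step.
  + destruct (HS i) as [v Hv]; [lia |].
    eapply reaches_trans; [apply IHf, Hv |].
    machine_step. apply IHr; lia.
Qed.

Definition halts (c x v n : nat) : bool :=
  Nat.iter n step (run c x 0) =? ret v 0.

Lemma halts_mono c x v n k : n <= k -> halts c x v n = true -> halts c x v k = true.
Proof.
unfold halts; rewrite !Nat.eqb_eq; intros Hk Hn.
replace k with ((k - n) + n) by lia; rewrite Nat.iter_add, Hn.
induction (k - n) as [| d IH]; [reflexivity |].
rewrite Nat.iter_succ, IH, step_retE; reflexivity.
Qed.

(** Finished states are fixed points of [step], so both runs agree at a common later time. With
    [eval_halts], this identifies a machine output with the value given by [eval], whenever there is
    one. *)
Lemma halts_inj c x v w n k :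
  halts c x v n = true -> halts c x w k = true -> v = w.
Proof.
intros Hv Hw.
apply (halts_mono _ _ _ _ (n + k)) in Hv, Hw; try lia.
unfold halts in Hv, Hw; rewrite Nat.eqb_eq in Hv, Hw.
rewrite Hv in Hw; apply (f_equal (fun s => pi1 (pi2 s))) in Hw.
unfold ret in Hw; now rewrite !pi2_pair, !pi1_pair in Hw.
Qed.

Lemma eval_halts c x v : eval c x v -> exists n, halts (encode c) x v n = true.
Proof.
intro H; destruct (eval_reaches c x v 0 H) as [n Hn].
exists n; now apply Nat.eqb_eq.
Qed.

(** * Bounded search, and trees given by parent functions *)

Definition search (P : nat -> bool) (n : nat) : nat :=
  nat_rect (fun _ => nat) 0
    (fun i v => if v <? i then v else if P i then i else S i) n.

(** In each round [v < i] records an earlier success and [v = i] failure so far; the result [n] thus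
    signals failure. *)
Lemma search_spec P n :
  (search P n < n /\ P (search P n) = true /\
   forall j, j < search P n -> P j = false) \/
  (search P n = n /\ forall j, j < n -> P j = false).
Proof.
induction n as [| n IH]; [right; split; [reflexivity | lia] |].
unfold search; cbn [nat_rect]; fold (search P n).
destruct IH as [(H1 & H2 & H3) | (H1 & H2)].
- left; apply Nat.ltb_lt in H1 as H; rewrite H; auto.
- rewrite H1, Nat.ltb_irrefl; destruct (P n) eqn:E.
  + left; auto.
  + right; split; [reflexivity |]; intros j Hj.
    destruct (Nat.eq_dec j n) as [-> |]; [trivial | apply H2; lia].
Qed.

(** A function [f] with [f z < z] for [z > 0] encodes a tree on [nat] with root
    [0]: the parent of [z] is [pi1 (f z)], and the edge joining them has the
    label [pi2 (f z)]. [below f <<x, l>> z] says that the path from [x] down to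
    [z] is nontrivial and starts with an edge of label at least [l]. *)
Inductive below (f : nat -> nat) (m : nat) : nat -> Prop :=
| below_child z : 0 < z -> pi1 (f z) = pi1 m -> pi2 m <= pi2 (f z) -> below f m z
| below_step z : 0 < z -> below f m (pi1 (f z)) -> below f m z.

Definition childb (f : nat -> nat) (m z : nat) : bool :=
  ((0 <? z) && ((pi1 (f z) =? pi1 m) && (pi2 m <=? pi2 (f z))))%bool.

(** Climbs from [z] and stops at a suitable child of the centre; parents decrease, so [z] steps
    suffice. *)
Definition belowb (f : nat -> nat) (m z : nat) : bool :=
  childb f m
    (Nat.iter z (fun y => if childb f m y then y else pi1 (f y)) z).

Lemma childb_spec f m z :
  childb f m z = true <-> 0 < z /\ pi1 (f z) = pi1 m /\ pi2 m <= pi2 (f z).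
Proof.
unfold childb.
now rewrite !Bool.andb_true_iff, Nat.ltb_lt, Nat.eqb_eq, Nat.leb_le.
Qed.

Lemma belowb_spec f m z :
  (forall y, y <= z -> f y <= Nat.pred y) -> belowb f m z = true <-> below f m z.
Proof.
intro Hf; unfold belowb.
set (g := fun y => if childb f m y then y else pi1 (f y)).
enough (E : forall n y, y <= n -> y <= z ->
  childb f m (Nat.iter n g y) = true <-> below f m y) by (apply E; lia).
induction n as [| n IH]; intros y Hn Hz.
- assert (y = 0) as -> by lia; split; [discriminate |].
  intro H; inversion H; lia.
- pose proof (Hf y Hz) as Hy; pose proof (pi1_le (f y)) as Hp.
  rewrite Nat.iter_succ_r; change (g y) with (if childb f m y then y else pi1 (f y)).
  destruct (childb f m y) eqn:E.
  + apply childb_spec in E as (E1 & E2 & E3).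
    split; [intros _; now apply below_child |].
    intros _; enough (Hi : forall k, Nat.iter k g y = y)
      by (rewrite Hi; now apply childb_spec).
    induction k as [| k IHk]; [reflexivity |].
    rewrite Nat.iter_succ, IHk; unfold g.
    now rewrite (proj2 (childb_spec f m y)).
  + rewrite IH by lia.
    split; intro H.
    * destruct (Nat.eq_dec y 0) as [-> | ?]; [| apply below_step; [lia | trivial]].
      now replace (pi1 (f 0)) with 0 in H by lia.
    * destruct H as [y H1 H2 H3 |]; [| trivial].
      rewrite (proj2 (childb_spec f m y)) in E by auto; discriminate.
Qed.

Lemma below_trans f m n z :
  below f m (pi1 n) -> below f n z -> below f m z.
Proof.
intros Hm Hn; induction Hn as [z H1 H2 H3 | z H1 H2 IH];
  apply below_step; trivial; now rewrite H2.
Qed.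

Lemma below_weaken f m n z :
  pi1 m = pi1 n -> pi2 m <= pi2 n -> below f n z -> below f m z.
Proof.
intros H1 H2 Hn; induction Hn as [z H3 H4 H5 | z H3 H4 IH];
  [apply below_child; [trivial | congruence | lia] | now apply below_step].
Qed.

(** Ancestors of [z] are at most [z], so a finite history decides the relation. *)
Lemma below_ext f g m z :
  (forall y, y <= z -> f y <= y) -> (forall y, y <= z -> f y = g y) ->
  below f m z -> below g m z.
Proof.
intros Hf Hfg Hb; induction Hb as [z H1 H2 H3 | z H1 H2 IH].
- rewrite Hfg in H2, H3 by lia; now apply below_child.
- pose proof (Hf z (le_n z)); pose proof (pi1_le (f z)).
  apply below_step; [trivial |]; rewrite <- Hfg by lia.
  apply IH; intros y Hy; [apply Hf | apply Hfg]; lia.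
Qed.

(** * The greedy construction of the tree *)

Definition lookup (h n y : nat) : nat := pi2 (Nat.iter (n - S y) pi1 h).

(** The pair [q = <<x, d x>>] allows the requirement [e] to move from the basic
    set [m] to the basic set [pi2 q] at stage [z]. As [q < z] in the search below,
    the label of an edge is smaller than its lower end. *)
Definition candidate (h z e m q : nat) : bool :=
  (halts (pi1 e) (pi1 q) 1 z && (halts (pi2 e) (pi1 q) (pi2 q) z &&
   ((e <=? pi1 (pi2 q)) && belowb (lookup h z) m (pi1 (pi2 q)))))%bool.

Definition refine (h z e m : nat) : nat :=
  if search (candidate h z e m) z <? z then pi2 (search (candidate h z e m) z)
  else m.

Definition approx (h z k : nat) : nat :=
  nat_rect (fun _ => nat) 0 (refine h z) k.

(** Course-of-values recursion: the earlier values of the tree are packed into one number, the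
    latest outermost. *)
Definition history (n : nat) : nat :=
  nat_rect (fun _ => nat) 0 (fun z h => <<h, approx h z z>>) n.

Definition tree (z : nat) : nat := approx (history z) z z.

Lemma comp_history f : comp f -> comp (fun x => history (f x)).
Proof.
apply comp_app; unfold history, approx, refine, candidate, belowb, childb, search,
  lookup, halts, run, ret.
pose proof (comp_step _ comp_id) as Hstep.
computable.
Qed.

Lemma lookup_history n y : y < n -> lookup (history n) n y = tree y.
Proof.
induction n as [| n IH]; intro H; [lia |].
unfold lookup; change (history (S n)) with <<history n, tree n>>.
destruct (Nat.eq_dec y n) as [-> | Hy].
- rewrite Nat.sub_diag; apply pi2_pair.
- replace (S n - S y) with (S (n - S y)) by lia.
  rewrite Nat.iter_succ_r, pi1_pair; apply IH; lia.
Qed.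

(** A chosen pair satisfies [pi2 q <= q < z]; this bounds parents and labels at once. *)
Lemma approx_le h z k : approx h z k <= Nat.pred z.
Proof.
induction k as [| k IH]; [apply Nat.le_0_l |].
change (refine h z k (approx h z k) <= Nat.pred z); unfold refine.
destruct (Nat.ltb_spec (search (candidate h z k (approx h z k)) z) z); [| trivial].
pose proof (pi2_le (search (candidate h z k (approx h z k)) z)); lia.
Qed.

Lemma tree_le z : tree z <= Nat.pred z.
Proof. apply approx_le. Qed.

Lemma belowb_lookup n m z :
  z < n -> belowb (lookup (history n) n) m z = true <-> below tree m z.
Proof.
intro Hz.
assert (H : forall y, y <= z -> lookup (history n) n y = tree y)
  by (intros; apply lookup_history; lia).
rewrite belowb_spec.
- split; apply below_ext; intros y Hy; rewrite ?H by trivial;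
    pose proof (tree_le y); lia.
- intros y Hy; rewrite H by trivial; apply tree_le.
Qed.

(** This is [candidate] read in the finished tree: [z] remains only as a step bound, which gives
    monotonicity. *)
Definition valid (z e m q : nat) : Prop :=
  halts (pi1 e) (pi1 q) 1 z = true /\ halts (pi2 e) (pi1 q) (pi2 q) z = true /\
  e <= pi1 (pi2 q) /\ below tree m (pi1 (pi2 q)).

Lemma valid_mono z z' e m q : z <= z' -> valid z e m q -> valid z' e m q.
Proof.
intros Hz (H1 & H2 & H3 & H4).
repeat split; trivial; now apply halts_mono with z.
Qed.

Lemma candidate_spec z e m q :
  q < z -> candidate (history z) z e m q = true <-> valid z e m q.
Proof.
intro Hq; unfold candidate, valid.
rewrite !Bool.andb_true_iff, Nat.leb_le, belowb_lookup; [tauto |].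
pose proof (pi1_le (pi2 q)); pose proof (pi2_le q); lia.
Qed.

(** The basic set into which stage [z] is aiming after the requirements below
    [k] have been visited. *)
Definition target (z k : nat) : nat := approx (history z) z k.

Lemma target_succ z e :
  (exists q, q < z /\ valid z e (target z e) q /\
    (forall j, j < q -> ~ valid z e (target z e) j) /\ target z (S e) = pi2 q) \/
  ((forall q, q < z -> ~ valid z e (target z e) q) /\ target z (S e) = target z e).
Proof.
change (target z (S e)) with (refine (history z) z e (target z e)); unfold refine.
destruct (search_spec (candidate (history z) z e (target z e)) z)
  as [(H1 & H2 & H3) | (H1 & H2)].
- left; exists (search (candidate (history z) z e (target z e)) z).
  rewrite (proj2 (Nat.ltb_lt _ _) H1).
  split; [trivial | split; [now apply candidate_spec | split; [| reflexivity]]].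
  intros j Hj Hv; apply candidate_spec in Hv; [| lia].
  rewrite H3 in Hv by trivial; discriminate.
- right; rewrite H1, Nat.ltb_irrefl; split; trivial.
  intros q Hq Hv; apply candidate_spec in Hv; [| trivial].
  rewrite H2 in Hv by trivial; discriminate.
Qed.

(** * Stabilization of the targets *)

Lemma least_witness (P : nat -> Prop) :
  (exists n, P n) -> exists n, P n /\ forall j, j < n -> ~ P j.
Proof.
intros [n Hn]; revert Hn; induction n as [n IH] using lt_wf_ind; intro Hn.
destruct (classic (exists j, j < n /\ P j)) as [(j & Hj & HP) | H].
- exact (IH j Hj HP).
- exists n; split; [trivial |]; intros j Hj HP; apply H; now exists j.
Qed.

(** Validity persists, so the least [q] that is ever valid is chosen from some stage on; if there is
    none, the target never moves. *)
Lemma target_succ_limit e m s :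
  (forall z, s <= z -> target z e = m) ->
  (exists q z0, forall z, z0 <= z -> valid z e m q /\ target z (S e) = pi2 q) \/
  (forall z, s <= z ->
     (forall q, q < z -> ~ valid z e m q) /\ target z (S e) = m).
Proof.
intro Hs.
destruct (classic (exists q z, s <= z /\ q < z /\ valid z e m q)) as [H | H].
- left; apply least_witness in H as (q & (z0 & H1 & H2 & H3) & Hq).
  exists q, z0; intros z Hz.
  assert (Hv : valid z e m q) by now apply valid_mono with z0.
  split; [trivial |].
  pose proof (target_succ z e) as Ht; rewrite (Hs z) in Ht by lia.
  destruct Ht as [(q' & H4 & H5 & H6 & ->) | (H4 & _)]; [| destruct (H4 q); [lia | trivial]].
  destruct (Nat.lt_trichotomy q q') as [? | [-> | ?]]; trivial.
  + destruct (H6 q); trivial.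
  + destruct (Hq q'); trivial; exists z; split; [lia | now split].
- right; intros z Hz; assert (H0 : forall q, q < z -> ~ valid z e m q)
    by (intros q H1 H2; apply H; now exists q, z).
  split; [trivial |].
  pose proof (target_succ z e) as Ht; rewrite (Hs z) in Ht by trivial.
  destruct Ht as [(q & H1 & H2 & _) | (_ & ->)]; [destruct (H0 q); trivial | trivial].
Qed.

Lemma target_limit e : exists m s, forall z, s <= z -> target z e = m.
Proof.
induction e as [| e (m & s & Hs)]; [now exists 0, 0 |].
destruct (target_succ_limit e m s Hs) as [(q & z0 & H) | H].
- exists (pi2 q), z0; intros; now apply H.
- exists m, s; intros; now apply H.
Qed.

(** Downward induction from [e = z], where the target is [tree z] itself. Each requirement moves
    only to a centre inside the current set, so going back [below_trans] applies. *)
Lemma below_target z e : 0 < z -> e <= z -> below tree (target z e) z.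
Proof.
intros Hz He; replace e with (z - (z - e)) by lia.
induction (z - e) as [| k IH].
- rewrite Nat.sub_0_r; now apply below_child.
(* For [z <= k] the truncated differences are both 0. *)
- destruct (Nat.le_gt_cases z k) as [Hk | Hk];
    [now replace (z - S k) with (z - k) by lia |].
  replace (z - k) with (S (z - S k)) in IH by lia.
  destruct (target_succ z (z - S k)) as [(q & _ & (_ & _ & _ & H) & _ & E) | (_ & E)];
    rewrite E in IH; [| trivial].
  now apply below_trans with (pi2 q).
Qed.

(** * Edge labels and separation *)

Lemma labels_bounded x : exists B, forall z, 0 < z -> pi1 (tree z) = x -> pi2 (tree z) < B.
Proof.
destruct (target_limit (S x)) as (m & s & Hs).
(* Stages before [s] have labels below [s]; later edges at [x] all have label [pi2 m]. *)
exists (S (s + pi2 m)); intros z Hz Hx.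
destruct (Nat.le_gt_cases s z) as [Hsz | Hsz].
- enough (E : tree z = m) by (rewrite E; lia).
  rewrite <- (Hs z Hsz).
  assert (Hxz : S x <= z)
    by (pose proof (tree_le z); pose proof (pi1_le (tree z)); lia).
  (* A requirement [e > x] moves only to centres [>= e], so a final centre [x] was already fixed at
     [S x]. *)
  enough (H : forall e, S x <= e -> pi1 (target z e) = x -> target z e = target z (S x))
    by now apply H.
  intros e He; induction He as [| e He IH]; [trivial |].
  destruct (target_succ z e) as [(q & _ & (_ & _ & H & _) & _ & ->) | (_ & ->)];
    [lia | trivial].
- pose proof (tree_le z); pose proof (pi2_le (tree z)); lia.
Qed.

Lemma not_below_bound x B z :
  (forall z, 0 < z -> pi1 (tree z) = x -> pi2 (tree z) < B) -> ~ below tree <<x, B>> z.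
Proof.
intros HB H; induction H as [z H1 H2 H3 |]; [| trivial].
rewrite pi1_pair in H2; rewrite pi2_pair in H3; specialize (HB z H1 H2); lia.
Qed.

(** A path to [y] starts with an edge whose lower end is at most [y], hence with a label smaller
    than [y]. *)
Lemma not_below_label x y : ~ below tree <<x, y>> y.
Proof.
enough (H : forall z, z <= y -> ~ below tree <<x, y>> z) by now apply H.
intros z Hz H; induction H as [z H1 H2 H3 | z H1 H2 IH].
- rewrite pi2_pair in H3.
  pose proof (tree_le z); pose proof (pi2_le (tree z)); lia.
- pose proof (tree_le z); pose proof (pi1_le (tree z)); apply IH; lia.
Qed.

(** The ancestors of [z] form a chain, and the path from the upper centre passes through the lower
    one. *)
Lemma below_comparable m n z :
  pi1 m <> pi1 n -> below tree m z -> below tree n z ->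
  below tree m (pi1 n) \/ below tree n (pi1 m).
Proof.
intros Hmn Hm; induction Hm as [z H1 H2 H3 | z H1 H2 IH]; intro Hn.
- destruct Hn as [z H4 H5 H6 | z H4 H5]; [congruence |].
  right; now rewrite <- H2.
- destruct Hn as [z H4 H5 H6 | z H4 H5]; [left; now rewrite <- H5 | auto].
Qed.

(** * The space *)

Definition opens (m : nat) : Ensemble nat :=
  fun z => z = pi1 m \/ below tree m z.

Lemma uniformly_computable_opens : uniformly_computable opens.
Proof.
destruct (comp_if
  (fun t => pi2 t =? pi1 (pi1 t)) (fun _ => 1)
  (fun t => if belowb (lookup (history (S (pi2 t))) (S (pi2 t))) (pi1 t) (pi2 t)
            then 1 else 0)) as [c Hc].
- computable.
- computable.
- pose proof (comp_history _ comp_id) as Hhist.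
  unfold belowb, childb, lookup; computable.
- exists c; intros n x; specialize (Hc <<n, x>>); cbv beta in Hc.
  rewrite !pi1_pair, !pi2_pair in Hc; unfold opens.
  destruct (Nat.eqb_spec x (pi1 n)) as [E | E]; [tauto |].
  pose proof (belowb_lookup (S x) n x (Nat.lt_succ_diag_r x)) as Hb.
  destruct (belowb _ n x); split; intro H; trivial; exfalso.
  + apply H; right; now apply Hb.
  + destruct H as [H | H]; [tauto |]; apply Hb in H; discriminate.
Qed.

Lemma opens_cover x : Full_set nat x -> exists n, opens n x.
Proof. exists <<x, 0>>; left; now rewrite pi1_pair. Qed.

(** The code of a pair bounds both components, and at any point of [opens p] a label at least
    [pi2 p] gives a subset of [opens p]. *)
Lemma opens_kfun x m n :
  opens m x -> opens n x ->
  opens <<x, <<pi2 m, pi2 n>>>> x /\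
  Included nat (opens <<x, <<pi2 m, pi2 n>>>>) (Intersection nat (opens m) (opens n)).
Proof.
intros Hm Hn; split; [left; now rewrite pi1_pair |].
assert (H : forall p l, opens p x -> pi2 p <= l -> forall z, opens <<x, l>> z -> opens p z).
{ intros p l Hp Hl z [-> | Hz]; [now rewrite pi1_pair |]; right.
  destruct Hp as [-> | Hp].
  - apply (below_weaken tree p <<pi1 p, l>>); rewrite ?pi1_pair, ?pi2_pair; trivial.
  - apply (below_trans tree p <<x, l>>); rewrite ?pi1_pair; trivial. }
pose proof (Cantor.to_nat_non_decreasing (pi2 m) (pi2 n)).
intros z Hz; split; refine (H _ _ _ _ z Hz); trivial; lia.
Qed.

Definition space : CSC :=
  MkCSC (Full_set nat) opens (fun x m n => <<x, <<pi2 m, pi2 n>>>>)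
    (fun n x _ => Full_intro nat x) opens_cover opens_kfun.

(** * Boundedness arguments *)

Lemma Finite_bounded (A : Ensemble nat) :
  Finite nat A <-> exists N, forall x, A x -> x < N.
Proof.
assert (ext : forall A B : Ensemble nat, (forall x, A x <-> B x) -> A = B).
{ intros B C H; apply functional_extensionality; intro x.
  now apply propositional_extensionality. }
split.
- intro H; induction H as [| A H [N HN] x Hx].
  + exists 0; intros x [].
  + exists (S (N + x)); intros y Hy; apply Add_inv in Hy as [Hy | ->]; [| lia].
    specialize (HN y Hy); lia.
- intros [N HN]; revert A HN; induction N as [| N IH]; intros A HN.
  + rewrite (ext A (Empty_set nat)); [apply Empty_is_finite |].
    intro x; split; [intro H; specialize (HN x H); lia | intros []].
  + set (B := fun x => A x /\ x <> N).
    assert (HB : Finite nat B).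
    { apply IH; intros x [H1 H2]; specialize (HN x H1); lia. }
    destruct (classic (A N)) as [H | H].
    * rewrite (ext A (Add nat B N)).
      { apply Union_is_finite; [trivial | now intros []]. }
      intro x; split.
      { intro Hx; destruct (Nat.eq_dec x N) as [-> |];
          [right; constructor | left; now split]. }
      { intro Hx; apply Add_inv in Hx as [[] | <-]; trivial. }
    * rewrite (ext A B); [trivial |].
      intro x; split; [| now intros []].
      intro Hx; split; [trivial | congruence].
Qed.

Lemma preimage_bounded (Y : nat -> Prop) d K :
  (forall x y, Y x -> Y y -> d x = d y -> x = y) ->
  exists N, forall x, Y x -> d x < K -> x < N.
Proof.
intro Hd; induction K as [| K [N HN]]; [exists 0; lia |].
destruct (classic (exists x, Y x /\ d x = K)) as [(x0 & H1 & H2) | H].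
- exists (S (N + x0)); intros x Hx Hk.
  destruct (Nat.eq_dec (d x) K); [| specialize (HN x Hx); lia].
  rewrite (Hd x x0) by (trivial; congruence); lia.
- exists N; intros x Hx Hk; apply HN; trivial.
  enough (d x <> K) by lia; intro; apply H; now exists x.
Qed.

Lemma uniform_bound (P : nat -> nat -> Prop) N :
  (forall x, exists B, forall n, P x n -> n < B) ->
  exists B, forall x n, x < N -> P x n -> n < B.
Proof.
intro H; induction N as [| N [B HB]]; [exists 0; lia |].
destruct (H N) as [C HC]; exists (B + C); intros x n Hx Hn.
destruct (Nat.eq_dec x N) as [-> |]; [apply HC in Hn; lia |].
apply HB in Hn; lia.
Qed.

(** If all the basic sets [opens (d x)] had centres below [N], then they would
    have finitely many indices, as labels below a given point are bounded. *)
Lemma centres_unbounded (Y : Ensemble nat) d N :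
  ~ Finite nat Y ->
  (forall x, Y x -> forall y, Y y /\ opens (d x) y <-> y = x) ->
  exists x, Y x /\ N <= pi1 (d x).
Proof.
intros HY Hd; apply NNPP; intro Hno.
destruct (uniform_bound (fun x n => exists z, 0 < z /\ pi1 (tree z) = x /\ n = pi2 (tree z)) N)
  as [B HB].
{ intro x; destruct (labels_bounded x) as [B HB]; exists B.
  intros n (z & H1 & H2 & ->); auto. }
assert (bounded_label : forall m z, pi1 m < N -> below tree m z -> pi2 m < B).
{ intros m z Hm H; induction H as [z H1 H2 H3 |]; [| trivial].
  enough (pi2 (tree z) < B) by lia.
  apply HB with (pi1 m); [trivial |]; now exists z. }
assert (bounded_index : exists K, forall m, pi1 m < N -> pi2 m < B -> m < K).
{ destruct (uniform_bound (fun a m => a = pi1 m /\ pi2 m < B) N) as [K HK].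
  { intro a; destruct (uniform_bound (fun b m => m = <<a, b>>) B) as [K HK].
    { intro b; exists (S <<a, b>>); intros m ->; lia. }
    exists K; intros m [-> Hm]; apply HK with (pi2 m); [trivial | now rewrite pair_pi]. }
  exists K; intros m H1 H2; now apply HK with (pi1 m). }
destruct bounded_index as [K HK].
destruct (preimage_bounded Y d K) as [M HM].
{ intros x y Hx Hy E; apply (Hd y Hy); rewrite <- E; now apply (Hd x Hx). }
apply HY, Finite_bounded; exists (M + N); intros x Hx.
assert (HN : pi1 (d x) < N) by (apply Nat.nle_gt; intro; apply Hno; now exists x).
(* Either [x] is the centre, hence below [N], or it lies on a path whose first edge bounds the label
   of [d x]. *)
destruct (proj2 (Hd x Hx x) eq_refl) as [_ [E | Hb]]; [lia |].
enough (x < M) by lia.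
apply HM; [trivial |]; apply HK; [trivial |]; now apply bounded_label with x.
Qed.

Theorem theorem5p4 :
  exists X : CSC,
    infinite X /\ computable_CSC X /\
    (exists e : nat -> nat -> nat,
       computable2 (points X) e /\ effectively_Hausdorff_via X e) /\
    discrete X /\
    ~ (exists (Y : Ensemble nat) (YX : Included nat Y (points X)),
         infinite (subspace X Y YX) /\ computable_CSC (subspace X Y YX) /\
         exists d : nat -> nat,
           computable1 Y d /\ effectively_discrete_via (subspace X Y YX) d).
Proof.
exists space; split; [| split; [| split; [| split]]].
- intro H; apply Finite_bounded in H as [N HN].
  specialize (HN N (Full_intro nat N)); lia.
- split; [| split].
  + destruct (comp_const 1) as [c Hc]; exists c; intro x; split; [auto |].
    intro H; destruct (H (Full_intro nat x)).
  + exact uniformly_computable_opens.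
  + assert (H : comp (fun t => <<pi1 t, <<pi2 (pi1 (pi2 t)), pi2 (pi2 (pi2 t))>>>>))
      by computable.
    destruct H as [c Hc]; exists c; intros x m n _; specialize (Hc <<x, <<m, n>>>>).
    now rewrite !pi2_pair, !pi1_pair in Hc.
(* Each point serves as a computable label bound that cuts it off from the other's basic set. *)
- exists (fun x y => <<<<x, y>>, <<y, x>>>>); split.
  + assert (H : comp (fun t => <<<<pi1 t, pi2 t>>, <<pi2 t, pi1 t>>>>)) by computable.
    destruct H as [c Hc]; exists c; intros x y _ _; specialize (Hc <<x, y>>).
    now rewrite !pi2_pair, !pi1_pair in Hc.
  + intros x y _ _ Hxy; exists <<x, y>>, <<y, x>>.
    split; [reflexivity |].
    split; [left; now rewrite pi1_pair | split; [left; now rewrite pi1_pair |]].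
    split; [| intros z []].
    intros z Hz; apply Intersection_inv in Hz as [Hx Hy]; exfalso.
    destruct Hx as [-> | Hx], Hy as [Hz | Hy]; rewrite ?pi1_pair in *;
      [congruence | | |].
    * now apply not_below_label in Hy.
    * subst z; now apply not_below_label in Hx.
    * destruct (below_comparable <<x, y>> <<y, x>> z) as [H | H];
        rewrite ?pi1_pair in *; trivial; now apply not_below_label in H.
- intros x _; destruct (labels_bounded x) as [B HB]; exists <<x, B>>; split.
  + intros z [-> | Hz]; [rewrite pi1_pair; constructor |].
    now apply not_below_bound in Hz.
  + intros z []; left; now rewrite pi1_pair.
- intros (Y & YX & HY & [[a Ha] _] & d & [b Hb] & Hd).
  assert (Hd' : forall x, Y x -> forall y, Y y /\ opens (d x) y <-> y = x).
  { intros x Hx y; destruct (Hd x Hx) as [H1 H2]; split.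
    - intros [Hy Ho]; symmetry; apply Singleton_inv, H1; now split.
    - intros ->; destruct (Intersection_inv _ _ _ _ (H2 x (In_singleton nat x))).
      split; assumption. }
  (* The requirement for the supposed programs of [Y] and [d]. *)
  set (e := <<encode a, encode b>>).
  destruct (target_limit e) as (m & s & Hs).
  destruct (target_succ_limit e m s Hs) as [(q & z0 & H) | H].
  + destruct (H z0 (le_n z0)) as [(H1 & H2 & _) _].
    unfold e in H1, H2; rewrite pi1_pair in H1; rewrite pi2_pair in H2.
    assert (Yq : Y (pi1 q)).
    { apply NNPP; intro Hn; destruct (eval_halts _ _ _ (proj2 (Ha (pi1 q)) Hn)) as [n H0].
      discriminate (halts_inj _ _ _ _ _ _ H0 H1). }
    assert (Eq : pi2 q = d (pi1 q)).
    { destruct (eval_halts _ _ _ (Hb (pi1 q) Yq)) as [n H0].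
      exact (halts_inj _ _ _ _ _ _ H2 H0). }
    (* From stage [z0] on the target is [d (pi1 q)], so every large [z] lies in that basic set. *)
    apply HY, Finite_bounded; exists (S (z0 + S e + pi1 q)); intros z Yz.
    apply Nat.nle_gt; intro Hz.
    assert (E : z = pi1 q); [| lia].
    apply (Hd' (pi1 q) Yq); split; [trivial |]; right.
    rewrite <- Eq, <- (proj2 (H z ltac:(lia))); apply below_target; lia.
  (* A centre above [s] lies below the limit [m], and being above [e] it is admissible; once both
     programs have halted, [q] is valid, a contradiction. *)
  + destruct (centres_unbounded Y d (S (s + e)) HY Hd') as (x & Yx & Hx).
    destruct (eval_halts _ _ _ (proj1 (Ha x) Yx)) as [n1 H1].
    destruct (eval_halts _ _ _ (Hb x Yx)) as [n2 H2].
    set (q := <<x, d x>>); set (z := S (s + n1 + n2 + q)).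
    destruct (H z ltac:(lia)) as [H0 _]; apply (H0 q ltac:(lia)).
    unfold valid, q, e; rewrite !pi1_pair, !pi2_pair; fold e.
    repeat split; [apply halts_mono with n1 | apply halts_mono with n2 | |]; trivial;
      try lia.
    rewrite <- (Hs (pi1 (d x))) by lia; apply below_target; lia.
Qed.
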